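(* Let $\mathbf{X}$ be a star decomposable simplicial complex, let $W\subseteq V(\mathbf{X})$ be a set which induces a star partition of $\mathbf{X}$, and let $\prec$ be a total order on $W$ which induces a star decomposition of $\mathbf{X}$. Let $\prec'$ be the partial order on $V(\mathbf{X})$ derived from $\prec$. Then $\mathbf{X}$ is vertex decomposable in a shedding order extending $\prec'$ (that is, there is a total order on $V(\mathbf{X})$ which extends $\prec'$ and is a shedding order of $\mathbf{X}$).
   Context: Simplicial complexes are finite abstract simplicial complexes; the void complex $\emptyset$ is distinguished from $\{\emptyset\}$ (dimension $-1$). $V(\mathbf{X})$ is the vertex set; pure means all inclusion-wise maximal faces have equal dimension. For a vertex $v$: $\mathrm{lk}(v,\mathbf{X})=\{\sigma\setminus\{v\}: v\in\sigma\in\mathbf{X}\}$, $\mathrm{st}(v,\mathbf{X})=\{\sigma\in\mathbf{X}:\sigma\cup\{v\}\in\mathbf{X}\}$, and $\mathrm{st}(W',\mathbf{X})=\bigcup_{w\in W'}\mathrm{st}(w,\mathbf{X})$ for $W'\subseteq V(\mathbf{X})$. $\mathbf{X}-v$ is the complex of faces not containing $v$. Star partition: $W\subseteq V(\mathbf{X})$ induces a star partition of $\mathbf{X}$ if $\mathbf{X}=\mathrm{st}(W,\mathbf{X})$ and no two distinct vertices of $W$ are joined by an edge of $\mathbf{X}$. For a total order $\prec$ on $W$ put $W_{\succ w}=\{w'\in W:w'\succ w\}$, $W_{\succeq w}=\{w'\in W: w'\succeq w\}$. For $x\in W$, $W'\subseteq W$, the overlap is $\mathbf{O}(x,W')=\mathrm{lk}(x,\mathbf{X})\cap\mathrm{st}(W',\mathbf{X})$.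 Star decomposability is defined by induction on $k$ for pairs $(\mathbf{X},X)$ with $\mathbf{X}$ pure $k$-dimensional, $k\ge -1$, $X\subseteq V(\mathbf{X})$; $\mathbf{X}$ is star decomposable if $(\mathbf{X},X)$ is star decomposable for some $X\subseteq V(\mathbf{X})$. For $k=-1$, $(\{\emptyset\},\emptyset)$ is star decomposable (and for $\mathbf X=\{\emptyset\}$ we let $W=\emptyset$ with the empty order count as inducing a star partition and a star decomposition). For $k\ge 0$, $(\mathbf{X},X)$ is star decomposable if there is a nonempty $W\subseteq V(\mathbf{X})$ inducing a star partition of $\mathbf{X}$ and a total order $\prec$ on $W$ such that: (Order condition) $X=W_{\succeq w'}$ for some $w'\in W$; (Link condition) for every $w\in W$ other than the last vertex of $\prec$, there is a nonempty set $U\subseteq V(\mathrm{lk}(w,\mathbf{X}))$ such that $\mathrm{st}(U,\mathrm{lk}(w,\mathbf{X}))=\mathbf{O}(w,W_{\succ w})$ and the pair $(\mathrm{lk}(w,\mathbf{X}),U)$ is star decomposable; when $k=0$ this condition is regarded as automatically satisfied; (Last vertex condition) for the last vertex $\hat w$ of $\prec$, $\mathrm{lk}(\hat w,\mathbf{X})$ is star decomposable. An order $\prec$ on $W$ satisfying these conditions is said to induce a star decomposition of $(\mathbf{X},X)$; it induces a star decomposition of $\mathbf{X}$ if it does so for $(\mathbf X,X)$ for some $X$. Derived order: for $v\in V(\mathbf{X})$ let $p(v)$ be the $\prec$-last vertex $w\in W$ with $v\in\mathrm{st}(w,\mathbf{X})$ (so $p(w)=w$ for $w\in W$). The partial order $\prec'$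 on $V(\mathbf{X})$ derived from $\prec$ is: $v\prec' v'$ if $p(v)\prec p(v')$; $v\prec' w$ if $w\in W$, $p(v)=w$ and $v\ne w$; distinct $v,v'\notin W$ with $p(v)=p(v')$ are incomparable. Vertex decomposability: a $d$-dimensional complex $\mathbf{K}$ is vertex decomposable if it is pure and either it is a $d$-simplex (for $d=-1$ this is $\{\emptyset\}$), or there is a vertex $v$ such that $\mathbf{K}-v$ is $d$-dimensional vertex decomposable and $\mathrm{lk}(v,\mathbf{K})$ is $(d-1)$-dimensional vertex decomposable. A total order $v_1,\dots,v_n$ of $V(\mathbf{K})$ is a shedding order of a pure $d$-complex $\mathbf{K}$ if, with $\mathbf{K}_0=\mathbf{K}$ and $\mathbf{K}_i=\mathbf{K}_{i-1}-v_i$, for each $1\le i\le n-(d+1)$ the link $\mathrm{lk}(v_i,\mathbf{K}_{i-1})$ is $(d-1)$-dimensional vertex decomposable and $\mathbf{K}_i$ is $d$-dimensional vertex decomposable, and $\mathbf{K}_{n-(d+1)}$ is a $d$-simplex (the last $d+1$ vertices may come in any order). *)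

(* Defs.v *)
From mathcomp Require Import all_boot.

Set Implicit Arguments.
Unset Strict Implicit.
Unset Printing Implicit Defensive.

Section Complexes.

Variable T : finType.
Implicit Types (X K : {set {set T}}) (s t : {set T}) (U W : {set T}) (v w : T).

(* Elements of [T] need not be vertices. The void complex is [set0]; it is
   distinct from [[set set0]], the complex of dimension -1. *)
Definition simplicial_complex X : Prop :=
  forall s t, s \in X -> t \subset s -> t \in X.

Definition vertices X : {set T} := [set v | [set v] \in X].

Definition facets X : {set {set T}} := [set s | maxset [in X] s].

Definition pure X : Prop := {in facets X &, forall s t, #|s| = #|t|}.

(* The dimension plus one, so that dimension -1 is encoded by 0. The void
   complex also gets 0 and has to be excluded separately. *)
Definition dim1 X : nat := \max_(s in X) #|s|.

Definition link v X : {set {set T}} := [set s :\ v | s in X & v \in s].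

Definition star v X : {set {set T}} := [set s in X | v |: s \in X].

Definition stars W X : {set {set T}} := \bigcup_(w in W) star w X.

Definition deletion X v : {set {set T}} := [set s in X | v \notin s].

(* The first disjunct is a convention: no set of vertices of [[set set0]] has
   a nonvoid union of stars, and [set0] is declared to induce a star
   partition of it. *)
Definition star_partition X W : Prop :=
  [/\ W \subset vertices X,
      (X = [set set0] /\ W = set0) \/ X = stars W X
    & {in W &, forall w w', w != w' -> [set w; w'] \notin X}].

Definition strict_total_order_on W (prec : rel T) : Prop :=
  [/\ {in W, irreflexive prec},
      {in W & &, transitive prec}
    & {in W &, forall w w', w != w' -> prec w w' || prec w' w}].

Definition after W (prec : rel T) w : {set T} := [set w' in W | prec w w'].

Definition from_on W (prec : rel T) w : {set T} :=
  [set w' in W | (w' == w) || prec w w'].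

Definition is_last W (prec : rel T) w : Prop :=
  w \in W /\ {in W, forall w', w' != w -> prec w' w}.

Definition overlap X w W : {set {set T}} := link w X :&: stars W X.

(* [SD L U] stands for "the pair (L, U) is star decomposable" in dimension one
   less than that of [X]; the guard [1 < dim1 X] waives the link condition in
   dimension 0. *)
Definition star_decomposition_step (SD : {set {set T}} -> {set T} -> Prop)
    X (A W : {set T}) (prec : rel T) : Prop :=
  [/\ W != set0, star_partition X W, strict_total_order_on W prec
    & [/\ exists2 w, w \in W & A = from_on W prec w,
          1 < dim1 X ->
            forall w, w \in W -> ~ is_last W prec w ->
            exists U : {set T},
              [/\ U != set0, U \subset vertices (link w X),
                  stars U (link w X) = overlap X w (after W prec w)
                & SD (link w X) U]
        & forall w, is_last W prec w ->
            exists2 U : {set T},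
              U \subset vertices (link w X) & SD (link w X) U]].

(* Recursion on [n], the dimension plus one. *)
Fixpoint star_decomposition_at (n : nat) X (A W : {set T}) (prec : rel T)
    : Prop :=
  if n is n'.+1 then
    [/\ simplicial_complex X, pure X, dim1 X = n, A \subset vertices X
      & star_decomposition_step
          (fun L U => exists W' prec',
             star_decomposition_at n' L U W' prec') X A W prec]
  else [/\ X = [set set0], A = set0 & W = set0].

Definition induces_star_decomposition_pair X (A W : {set T}) (prec : rel T)
    : Prop :=
  star_decomposition_at (dim1 X) X A W prec.

Definition star_decomposable_pair X (A : {set T}) : Prop :=
  exists W prec, induces_star_decomposition_pair X A W prec.

Definition star_decomposable X : Prop :=
  exists2 A : {set T}, A \subset vertices X & star_decomposable_pair X A.

Definition induces_star_decomposition X W (prec : rel T) : Prop :=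
  exists2 A : {set T},
    A \subset vertices X & induces_star_decomposition_pair X A W prec.

(* The last vertex of [W] whose star contains [v]. When [v] is a vertex of [X]
   and [prec] strictly totally orders a nonempty [W] inducing a star partition
   of [X], there is exactly one candidate, so the default value is not used. *)
Definition last_star X W (prec : rel T) v : T :=
  odflt v [pick w in W | (v \in vertices (star w X)) &&
             [forall w' in W, (v \in vertices (star w' X)) ==>
                              (w' == w) || prec w' w]].

Definition derived_order X W (prec : rel T) : rel T := fun v v' =>
  [&& v \in vertices X, v' \in vertices X
    & prec (last_star X W prec v) (last_star X W prec v')
      || [&& v' \in W, last_star X W prec v == v' & v != v']].

Definition simplex s : {set {set T}} := powerset s.

Inductive vertex_decomposable : {set {set T}} -> Prop :=
| VD_simplex s : vertex_decomposable (simplex s)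
| VD_shed K v :
    simplicial_complex K -> pure K -> v \in vertices K ->
    dim1 (deletion K v) = dim1 K -> vertex_decomposable (deletion K v) ->
    (dim1 (link v K)).+1 = dim1 K -> vertex_decomposable (link v K) ->
    vertex_decomposable K.

Definition deletions K (vs : seq T) : {set {set T}} := foldl deletion K vs.

(* [vs] lists v_1, ..., v_n in increasing order. *)
Definition enumerates_vertices K (vs : seq T) : Prop :=
  uniq vs /\ vs =i vertices K.

(* In the decomposition [vs = us ++ v :: us'], [v] is v_i with
   [size us = i - 1], and [deletions K us] is K_(i-1). *)
Definition shedding_order K (vs : seq T) : Prop :=
  [/\ simplicial_complex K, pure K, enumerates_vertices K vs,
      forall us v us', vs = us ++ v :: us' -> size us < size vs - dim1 K ->
        let Kprev := deletions K us in
        let Knext := deletion Kprev v in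
        [/\ vertex_decomposable (link v Kprev),
            (dim1 (link v Kprev)).+1 = dim1 K,
            vertex_decomposable Knext
          & dim1 Knext = dim1 K]
    & exists2 s : {set T}, #|s| = dim1 K
        & deletions K (take (size vs - dim1 K) vs) = simplex s].

Definition extends (vs : seq T) (r : rel T) : Prop :=
  forall v v', r v v' -> index v vs < index v' vs.

End Complexes.

(* Main.v *)
(** Write X as Y u (w * L), where w is the first vertex of W, L = lk(w) and Y is
    the union of the remaining stars. By induction on the dimension L has a
    shedding order extending the order derived from the decomposition of
    (L, U), so the vertices of L outside Y, being those outside st(U, L), come
    first in it. Shedding such a v from Y u (w * L) has link w * lk(v, L) and
    leaves Y u (w * (L - v)). After all of them, L has become st(U, L), the
    overlap of w with Y, so w has this complex as link and its removal leaves
    Y. The star of the last vertex of W is a cone, shed along its base. *)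

Require Import Defs.
From mathcomp Require Import all_boot.

Set Implicit Arguments.
Unset Strict Implicit.
Unset Printing Implicit Defensive.

Section Complexes.

Variable T : finType.
Implicit Types (X K L Y M : {set {set T}}) (s t A U W : {set T}) (v w : T).

(** * Faces of links, stars and deletions *)

Lemma mem_link K v s :
  (s \in link v K) = (v \notin s) && (v |: s \in K).
Proof.
apply/imsetP/andP => [[t]|[vs Kvs]].
  by rewrite inE => /andP[Kt vt] ->; rewrite setD1K // !inE eqxx.
by exists (v |: s); rewrite ?inE ?Kvs ?eqxx // setU1K.
Qed.

Lemma mem_star K v s : simplicial_complex K -> (s \in star v K) = (v |: s \in K).
Proof.
move=> cK; rewrite inE; apply/andb_idl => Kvs.
by apply: cK Kvs _; apply: subsetU1.
Qed.

Lemma star_complex K v : simplicial_complex K -> simplicial_complex (star v K).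
Proof.
move=> cK s t; rewrite !mem_star // => Ks ts.
by apply: cK Ks _; apply: setUS.
Qed.

Lemma stars_complex K W : simplicial_complex K -> simplicial_complex (stars W K).
Proof.
move=> cK s t /bigcupP[w Ww ws] ts.
by apply/bigcupP; exists w => //; apply: star_complex ws ts.
Qed.

Lemma link_complex K v : simplicial_complex K -> simplicial_complex (link v K).
Proof.
move=> cK s t; rewrite !mem_link => /andP[vs Ks] ts.
rewrite (contra (subsetP ts v)) //=.
by apply: cK Ks _; apply: setUS.
Qed.

Lemma deletion_complex K v :
  simplicial_complex K -> simplicial_complex (deletion K v).
Proof.
move=> cK s t; rewrite !inE => /andP[Ks vs] ts.
by rewrite (cK _ _ Ks ts) (contra (subsetP ts v)).
Qed.

Lemma mem_deletions K us s :
  (s \in deletions K us) = (s \in K) && [forall v in s, v \notin us].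
Proof.
elim: us K => [|u us IH] K /=.
  by rewrite (introT forall_inP) ?andbT.
rewrite IH inE -andbA; congr andb.
apply/andP/forall_inP => [[us' /forall_inP H] v vs | H].
  rewrite inE negb_or H // andbT; apply: contraNneq us' => <-; exact: vs.
split; first by apply/negP => /H; rewrite inE eqxx.
by apply/forall_inP => v /H; rewrite inE negb_or => /andP[].
Qed.

Lemma deletions_complex K us :
  simplicial_complex K -> simplicial_complex (deletions K us).
Proof. by elim: us K => //= u us IH K cK; apply/IH/deletion_complex. Qed.

Lemma mem_vertices K s v : simplicial_complex K -> s \in K -> v \in s -> v \in vertices K.
Proof. by move=> cK Ks vs; rewrite inE; apply: cK Ks _; rewrite sub1set. Qed.

(** * Dimension, purity and vertex decomposability *)

Lemma leq_dim1 K s : s \in K -> #|s| <= dim1 K.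
Proof. exact: leq_bigmax_cond. Qed.

Lemma facet_above K s : s \in K -> exists2 t, t \in facets K & s \subset t.
Proof.
by move=> Ks; have [t mt st] := @maxset_exists _ [in K] s Ks; exists t; rewrite ?inE.
Qed.

Lemma card_facet K s : pure K -> s \in facets K -> #|s| = dim1 K.
Proof.
move=> pK fs; apply/eqP; rewrite eqn_leq leq_dim1 /=; last first.
  by move: fs; rewrite inE => /maxsetP[].
apply/bigmax_leqP => t Kt; have [u fu tu] := facet_above Kt.
by rewrite (pK _ _ fs fu) subset_leq_card.
Qed.

Lemma dim1_shed K v d :
    dim1 (deletion K v) = d -> (dim1 (link v K)).+1 = d -> dim1 K = d.
Proof.
move=> dK dL; apply/eqP; rewrite eqn_leq; apply/andP; split; last first.
  rewrite -dK; apply/bigmax_leqP => s; rewrite inE => /andP[Ks _].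
  exact: leq_dim1.
apply/bigmax_leqP => s Ks; have [vs|vs] := boolP (v \in s).
  rewrite (cardsD1 v) vs -dL ltnS; apply: leq_dim1.
  by rewrite mem_link !inE eqxx setD1K.
by rewrite -dK; apply: leq_dim1; rewrite inE Ks.
Qed.

Lemma vertex_decomposable_complex K :
  vertex_decomposable K -> simplicial_complex K.
Proof.
by case=> // s t u; rewrite !powersetE => ts /subset_trans; apply.
Qed.

Lemma dim1_simplex s : dim1 (simplex s) = #|s|.
Proof.
apply/eqP; rewrite eqn_leq leq_dim1 ?powersetE // andbT.
by apply/bigmax_leqP => t; rewrite powersetE; apply: subset_leq_card.
Qed.

Lemma vertex_decomposable_pure K : vertex_decomposable K -> pure K.
Proof.
case=> // s; have facetE t : t \in facets (simplex s) -> t = s.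
  rewrite inE => /maxsetP[]; rewrite powersetE => ts /(_ s).
  by rewrite powersetE => <-.
by move=> t u /facetE-> /facetE->.
Qed.

(** Purity is inherited from the two pieces: a facet containing [v] becomes a facet of the link once
    [v] is removed, and any other facet is a facet of the deletion. *)
Lemma vertex_decomposable_shed K v d :
    simplicial_complex K -> v \in vertices K ->
    vertex_decomposable (deletion K v) -> dim1 (deletion K v) = d ->
    vertex_decomposable (link v K) -> (dim1 (link v K)).+1 = d ->
  vertex_decomposable K.
Proof.
move=> cK vK vdK dK vdL dL; have dimK := dim1_shed dK dL.
apply: (@VD_shed _ _ v) => //; rewrite ?dimK //.
suff cardf s : s \in facets K -> #|s| = d by move=> s t /cardf-> /cardf->.
rewrite inE => /maxsetP[/= Ks maxs]; have [vs|vs] := boolP (v \in s).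
  rewrite (cardsD1 v) vs -dL; congr _.+1.
  apply: card_facet; first exact: vertex_decomposable_pure.
  rewrite inE; apply/maxsetP; split=> [|t /=].
    by rewrite mem_link !inE eqxx setD1K.
  rewrite mem_link => /andP[vt Kt] st; rewrite -(setU1K vt).
  by rewrite (maxs _ Kt) // -(setD1K vs) setUS.
rewrite -dK; apply: card_facet; first exact: vertex_decomposable_pure.
rewrite inE; apply/maxsetP; split=> [|t /=]; first by rewrite inE Ks.
by rewrite inE => /andP[Kt _] st; apply: maxs.
Qed.

(** * Cones and their shedding *)

Definition cone w L : {set {set T}} := [set s : {set T} | s :\ w \in L].

Lemma cone_complex w L : simplicial_complex L -> simplicial_complex (cone w L).
Proof.
by move=> cL s t; rewrite !inE => Ls ts; apply: cL Ls _; apply: setSD.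
Qed.

Lemma star_cone K w : simplicial_complex K -> star w K = cone w (link w K).
Proof.
move=> cK; apply/setP => s; rewrite mem_star // inE mem_link !inE eqxx /=.
by congr (_ \in K); apply/setP => v; rewrite !inE; case: eqVneq.
Qed.

Lemma deletion_setU_cone Y L w v :
    simplicial_complex Y -> v \notin vertices Y -> v != w ->
  deletion (Y :|: cone w L) v = Y :|: cone w (deletion L v).
Proof.
move=> cY vY vw; apply/setP => s; rewrite !inE vw /=.
have [Ys|//] := boolP (s \in Y); apply/negP => vs.
by case/negP: vY; apply: mem_vertices Ys vs.
Qed.

(** No face of [Y] contains [v], so the link is computed in the cone alone. *)
Lemma link_setU_cone Y L w v :
    simplicial_complex Y -> v \notin vertices Y -> v != w ->
  link v (Y :|: cone w L) = cone w (link v L).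
Proof.
move=> cY vY vw; apply/setP => s; rewrite mem_link !inE mem_link !inE vw /=.
have -> : (v |: s) :\ w = v |: s :\ w.
  by apply/setP => x; rewrite !inE; case: (eqVneq x v) => // ->; rewrite vw.
case: (v \in s) => //=; have [Ys|//] := boolP (v |: s \in Y).
by case/negP: vY; apply: mem_vertices Ys _ => //; rewrite !inE eqxx.
Qed.

Lemma deletion_cone L w v :
  v != w -> deletion (cone w L) v = cone w (deletion L v).
Proof.
by move=> vw; rewrite -[cone w L]set0U deletion_setU_cone ?set0U ?inE // => s; rewrite inE.
Qed.

Lemma link_cone L w v : v != w -> link v (cone w L) = cone w (link v L).
Proof.
by move=> vw; rewrite -[cone w L]set0U link_setU_cone ?inE // => s; rewrite inE.
Qed.

Lemma cone_simplex w s : cone w (simplex s) = simplex (w |: s).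
Proof. by apply/setP => t; rewrite !inE subDset. Qed.

Lemma vertex_decomposable_neq0 K : vertex_decomposable K -> K != set0.
Proof.
case=> [s|{}K v _ _ vK *]; apply/set0Pn.
  by exists s; rewrite powersetE.
by exists [set v]; rewrite inE in vK.
Qed.

(** Nonvoidness matters: the cone over the void complex is void, and [dim1] is 0 for both. *)
Lemma dim1_cone w L :
    simplicial_complex L -> L != set0 -> w \notin vertices L ->
  dim1 (cone w L) = (dim1 L).+1.
Proof.
move=> cL L0 wL; have notin s : s \in L -> w \notin s.
  by move=> Ls; apply: contra wL; apply: mem_vertices.
apply/eqP; rewrite eqn_leq; apply/andP; split.
  apply/bigmax_leqP => s; rewrite inE => Ls.
  by rewrite (cardsD1 w) -add1n leq_add ?leq_dim1 //; case: (w \in s).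
have L_gt0 : 0 < #|L| by rewrite card_gt0.
have [s Ls Es] := eq_bigmax_cond (fun s : {set T} => #|s|) L_gt0; rewrite /dim1 Es.
have <- : #|w |: s| = #|s|.+1 by rewrite cardsU1 notin.
by apply: leq_dim1; rewrite inE setU1K // notin.
Qed.

Lemma link_vertices K v : simplicial_complex K ->
  vertices (link v K) \subset vertices K :\ v.
Proof.
move=> cK; apply/subsetP => x; rewrite !inE mem_link inE eq_sym => /andP[-> Ks].
by apply: cK Ks _; rewrite subsetUr.
Qed.

Lemma vertices_deletion K v : vertices (deletion K v) = vertices K :\ v.
Proof. by apply/setP => x; rewrite !inE andbC eq_sym. Qed.

(** Away from the apex, deletion and link commute with coning, so a shedding of [L] also sheds the
    cone; the cone over a simplex is a simplex. *)
Lemma vertex_decomposable_cone w L :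
  vertex_decomposable L -> w \notin vertices L -> vertex_decomposable (cone w L).
Proof.
elim=> [s _|{}L v cL pL vL dD vdD IHD dK vdK IHK wL].
  by rewrite cone_simplex; apply: VD_simplex.
have vw : v != w by apply: contraNneq wL => <-.
have wD : w \notin vertices (deletion L v).
  by rewrite vertices_deletion in_setD1 negb_and wL orbT.
have wK : w \notin vertices (link v L).
  apply: contra wL => /(subsetP (link_vertices _ cL)).
  by rewrite in_setD1 => /andP[].
apply: (@vertex_decomposable_shed _ v (dim1 L).+1).
- exact: cone_complex.
- by rewrite !inE in vL *; apply: cL vL _; apply: subsetDl.
- by rewrite deletion_cone //; apply: IHD.
- rewrite deletion_cone // dim1_cone ?dD //; first exact: deletion_complex.
  exact: vertex_decomposable_neq0.
- by rewrite link_cone //; apply: IHK.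
- rewrite link_cone // dim1_cone ?dK //; first exact: link_complex.
  exact: vertex_decomposable_neq0.
Qed.

(** * Shedding sequences *)

(** Only the links are constrained. Vertex decomposability and dimension of the intermediate
    complexes are recovered backwards from the last one. *)
Fixpoint sheds d K (us : seq T) : Prop :=
  if us is v :: us' then
    [/\ v \in vertices K, vertex_decomposable (link v K),
        (dim1 (link v K)).+1 = d & sheds d (deletion K v) us']
  else True.

Lemma sheds_cat d K us us' :
  sheds d K (us ++ us') <-> sheds d K us /\ sheds d (deletions K us) us'.
Proof.
elim: us K => [|u us IH] K /=; first by split=> [|[]].
split=> [[? ? ? /IH[]]|[[? ? ? ?] ?]]; split=> //.
by apply/IH.
Qed.

Lemma sheds_vertex_decomposable d K us :
    simplicial_complex K -> sheds d K us ->
    vertex_decomposable (deletions K us) -> dim1 (deletions K us) = d ->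
  vertex_decomposable K /\ dim1 K = d.
Proof.
elim: us K => [|u us IH] K //= cK [uK vdL dL shD] vdD dD.
have [vdD1 dD1] := IH _ (deletion_complex cK) shD vdD dD.
split; last exact: dim1_shed dD1 dL.
exact: vertex_decomposable_shed uK vdD1 dD1 vdL dL.
Qed.

Lemma deletions_setU_cone Y L w us :
    simplicial_complex Y ->
    {in us, forall v, v \notin vertices Y /\ v != w} ->
  deletions (Y :|: cone w L) us = Y :|: cone w (deletions L us).
Proof.
move=> cY; elim: us L => [|u us IH] L //= usY.
have [uY uw] := usY u (mem_head _ _).
rewrite deletion_setU_cone // IH // => v vus.
by apply: usY; rewrite inE vus orbT.
Qed.

(** The links of the shed vertices become cones with apex [w], which raises the dimension parameter
    by one. *)
Lemma sheds_setU_cone d Y L w us :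
    simplicial_complex Y -> simplicial_complex L -> w \notin vertices L ->
    {in us, forall v, v \notin vertices Y /\ v != w} ->
  sheds d L us -> sheds d.+1 (Y :|: cone w L) us.
Proof.
move=> cY; elim: us L => [|u us IH] L cL wL //= usY [uL vdK dK shD].
have [uY uw] := usY u (mem_head _ _).
have wK : w \notin vertices (link u L).
  apply: contra wL => /(subsetP (link_vertices _ cL)).
  by rewrite in_setD1 => /andP[].
rewrite link_setU_cone // deletion_setU_cone //; split.
- rewrite !inE in uL *; apply/orP; right.
  by apply: cL uL _; apply: subsetDl.
- exact: vertex_decomposable_cone.
- rewrite dim1_cone ?dK //; first exact: link_complex.
  exact: vertex_decomposable_neq0.
- apply: IH => //; first exact: deletion_complex.
    by rewrite vertices_deletion in_setD1 negb_and wL orbT.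
  by move=> v vus; apply: usY; rewrite inE vus orbT.
Qed.

(** Here [d] is the dimension plus one, [us] lists the vertices actually shed, and [rest] those of
    the final simplex. *)
Definition shedding_split d K (us rest : seq T) : Prop :=
  [/\ uniq (us ++ rest), us ++ rest =i vertices K, sheds d K us, size rest = d
    & exists2 s : {set T}, #|s| = d & deletions K us = simplex s].

(** Shedding [us'] reduces [deletions K us] to a simplex; putting these vertices back one at a time
    preserves vertex decomposability and dimension. *)
Lemma shedding_split_vertex_decomposable d K us us' rest :
    simplicial_complex K -> shedding_split d K (us ++ us') rest ->
  vertex_decomposable (deletions K us) /\ dim1 (deletions K us) = d.
Proof.
move=> cK [_ _ /sheds_cat[_ sh] _ [s ds Ks]].
apply: sheds_vertex_decomposable sh _ _; first exact: deletions_complex.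
  by rewrite /deletions -foldl_cat -/(deletions _ _) Ks; apply: VD_simplex.
by rewrite /deletions -foldl_cat -/(deletions _ _) Ks dim1_simplex.
Qed.

Lemma shedding_split_order d K us rest :
  simplicial_complex K -> shedding_split d K us rest ->
  shedding_order K (us ++ rest).
Proof.
move=> cK sp; have [vdK dK] := @shedding_split_vertex_decomposable _ _ [::] _ _ cK sp.
rewrite /= in vdK dK; have [uniq_vs vsE sh rest_d [s ds Ks]] := sp.
have size_us : size (us ++ rest) - dim1 K = size us.
  by rewrite size_cat rest_d dK addnK.
split=> //; [exact: vertex_decomposable_pure| |]; last first.
  by exists s; [rewrite dK | rewrite size_us take_size_cat].
move=> us1 v us2 Evs; rewrite size_us => lt_us.
(* The position of [v] is below [size us], so [v] occurs in [us] and not in [rest]. *)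
have Eus : us = (us1 ++ [:: v]) ++ drop (size us1).+1 us.
  rewrite -[LHS](cat_take_drop (size us1).+1); congr cat.
  rewrite -(@takel_cat _ _ us rest) ?Evs // -cat1s catA.
  by rewrite take_size_cat // size_cat addn1.
rewrite Eus in sp; have [vdN dN] := shedding_split_vertex_decomposable cK sp.
move: sh; rewrite Eus => /sheds_cat[/sheds_cat[_ [_ vdL dL _]] _].
by move: vdN dN; rewrite /deletions foldl_cat /= dK.
Qed.

(** * Sequences and total orders *)

Lemma filter_prefix (P : pred T) (s : seq T) :
  pairwise (fun x y => P y ==> P x) s ->
  s = filter P s ++ filter (predC P) s.
Proof.
elim: s => //= x s IH /andP[/allP xs /IH sE].
have [Px|nPx] := boolP (P x); rewrite /= {1}sE //.
have -> : filter P s = [::].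
  apply/eqP; rewrite -(negbK (_ == _)) -has_filter; apply/hasPn => y /xs.
  by rewrite (negPf nPx) implybF.
by [].
Qed.

(** The pairwise form behaves well under concatenation, so the induction carries it; irreflexivity
    rules out equal positions at the end. *)
Lemma pairwise_extends (r : rel T) (vs : seq T) :
    irreflexive r -> (forall x y, r x y -> x \in vs /\ y \in vs) ->
    pairwise (fun x y => ~~ r y x) vs ->
  extends vs r.
Proof.
move=> irr sub pw x y rxy; have [xs ys] := sub _ _ rxy.
rewrite ltnNge leq_eqVlt; apply/negP => /orP[/eqP Exy|lt_yx].
  have Eyx : y = x by rewrite -(nth_index x ys) Exy nth_index.
  by rewrite Eyx irr in rxy.
have /(pairwiseP x)/(_ _ _ _ _ lt_yx) := pw.
by rewrite !inE !index_mem !nth_index // rxy => /(_ ys xs).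
Qed.

Section TotalOrder.

Variables (W : {set T}) (prec : rel T).
Hypothesis ordW : strict_total_order_on W prec.

Lemma prec_irr w : w \in W -> prec w w = false.
Proof. by case: ordW => irr _ _; apply: irr. Qed.

Lemma prec_trans w1 w2 w3 : w1 \in W -> w2 \in W -> w3 \in W ->
  prec w1 w2 -> prec w2 w3 -> prec w1 w3.
Proof. by case: ordW => _ tr _ W1 W2 W3; apply: tr. Qed.

Lemma prec_sorted : exists2 ws : seq T, ws =i W & pairwise prec ws.
Proof.
(* Sorting uses the reflexive closure [le]; strictness returns because the sorted list has no
   repetitions. *)
case: ordW => irr tr tot; pose le x y := (x == y) || prec x y.
have totle : {in W &, total le}.
  move=> x y Wx Wy; rewrite /le (eq_sym y); case: eqVneq => //= xy; exact: tot.
have trle : {in W & &, transitive le}.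
  move=> y x z Wy Wx Wz; rewrite /le => /orP[/eqP-> //|xy] /orP[/eqP<-|yz].
    by rewrite xy orbT.
  by rewrite (tr y x z) ?orbT.
have allW : all [in W] (enum W) by apply/allP => x; rewrite mem_enum.
have memE : sort le (enum W) =i W by move=> x; rewrite mem_sort mem_enum.
exists (sort le (enum W)) => //.
have := sort_sorted_in totle allW.
rewrite (sorted_pairwise_in trle) ?all_sort // => ple.
have pne : pairwise (fun x y => x != y) (sort le (enum W)).
  by rewrite -uniq_pairwise sort_uniq enum_uniq.
have : pairwise [rel x y | le x y && (x != y)] (sort le (enum W)).
  by rewrite pairwise_relI ple.
by apply: sub_pairwise => x y /= /andP[/orP[/eqP->|//]]; rewrite eqxx.
Qed.

Lemma exists_last (P : pred T) w0 : w0 \in W -> P w0 ->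
  exists2 w, w \in W & P w /\ {in W, forall w', P w' -> (w' == w) || prec w' w}.
Proof.
have [ws wsE pw] := prec_sorted.
move=> Ww0 Pw0; case Es : {1}(filter P ws) / (lastP (filter P ws)) => [|s w].
  have: w0 \in filter P ws by rewrite mem_filter Pw0 wsE.
  by rewrite Es.
have: w \in filter P ws by rewrite Es mem_rcons mem_head.
rewrite mem_filter wsE => /andP[Pw Ww]; exists w => //; split=> // w' Ww' Pw'.
have: w' \in filter P ws by rewrite mem_filter Pw' wsE.
rewrite Es mem_rcons inE => /orP[-> //|sw'].
have: pairwise prec (rcons s w) by rewrite -Es pairwise_filter.
by rewrite pairwise_rcons => /andP[/allP->]; rewrite ?orbT.
Qed.

(** With this, an induction along [W] becomes one on the suffixes of a sorted enumeration. *)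
Lemma after_suffix (pre : seq T) w (t : seq T) :
    pre ++ w :: t =i W -> pairwise prec (pre ++ w :: t) ->
  after W prec w = [set x in t].
Proof.
move=> wsE pw.
move: pw; rewrite pairwise_cat allrel_consr /= => /and3P[/andP[/allP pre_w _] _ /andP[/allP w_t _]].
have Ww : w \in W by rewrite -wsE mem_cat mem_head orbT.
apply/setP => x; rewrite !inE; apply/andP/idP => [[Wx wx]|xt]; last first.
  by rewrite w_t // -wsE mem_cat inE xt !orbT.
move: (Wx); rewrite -wsE mem_cat inE => /or3P[xpre|/eqP xw|//].
  have /prec_irr : w \in W by [].
  by rewrite (prec_trans _ _ _ wx (pre_w _ xpre)).
by rewrite xw prec_irr in wx.
Qed.

End TotalOrder.

(** * Star partitions and the derived order *)

Section StarPartition.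

Variables (X : {set {set T}}) (W : {set T}) (prec : rel T).
Hypotheses (cX : simplicial_complex X) (ordW : strict_total_order_on W prec).
Hypotheses (WX : W \subset vertices X) (XW : X = stars W X).
Hypothesis indepW : {in W &, forall w w', w != w' -> [set w; w'] \notin X}.

Local Notation p := (last_star X W prec).

(** The stars cover [X], so some star contains [v] and there is a last such one; the default value
    in [last_star] is never reached. *)
Lemma last_starP v : v \in vertices X ->
  [/\ p v \in W, v \in vertices (star (p v) X)
    & {in W, forall w', v \in vertices (star w' X) -> (w' == p v) || prec w' (p v)}].
Proof.
rewrite inE => vX; have /bigcupP[w0 Ww0 vw0] : [set v] \in stars W X by rewrite -XW.
rewrite /last_star.
case: pickP => [w /and3P[Ww vw /forall_inP maxw]|none] /=.
  by split=> // w' Ww' vw'; apply: (implyP (maxw _ Ww')).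
have [||w Ww [vw maxw]] := @exists_last _ _ ordW (fun w => v \in vertices (star w X)) w0 => //.
  by rewrite inE.
have /negP[] := none w; apply/and3P; split=> //; apply/forall_inP => w' Ww'.
by apply/implyP; apply: maxw.
Qed.

(** Otherwise [[set w; w']] would be an edge between two vertices of [W]. *)
Lemma star_vertex_W w w' : w \in W -> w' \in W -> w \in vertices (star w' X) -> w = w'.
Proof.
move=> Ww Ww'; rewrite inE mem_star // => Xww; apply/eqP.
by apply: contraTT Xww; rewrite eq_sym; apply: indepW.
Qed.

Lemma last_starW w : w \in W -> p w = w.
Proof.
move=> Ww; have [Wp wp _] := last_starP (subsetP WX _ Ww).
by rewrite -(star_vertex_W Ww Wp wp).
Qed.

Lemma derived_order_irr : irreflexive (derived_order X W prec).
Proof.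
move=> v; rewrite /derived_order eqxx !andbF orbF; apply/negP => /and3P[vX _].
by have [Wp _ _] := last_starP vX; rewrite (prec_irr ordW Wp).
Qed.

End StarPartition.

(** * Final segments of a star decomposition *)

Lemma from_onP W (prec : rel T) w x : strict_total_order_on W prec -> w \in W ->
  x \in W -> x \notin from_on W prec w -> {in from_on W prec w, forall y, prec x y}.
Proof.
move=> ordW Ww Wx; rewrite inE Wx /= negb_or => /andP[xw wx] y.
have xltw : prec x w.
  by case: (ordW) => _ _ /(_ _ _ Wx Ww xw)/orP[//|wx']; rewrite wx' in wx.
by rewrite inE => /andP[Wy /orP[/eqP->//|]]; apply: (prec_trans ordW).
Qed.

(* The subcomplex induced on the vertices of a final segment of stars is the
   union of these stars; hence shedding the vertices outside the overlap turns
   the link of [w] into the overlap. *)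
Lemma stars_induced n X A W prec F :
    star_decomposition_at n X A W prec -> A != set0 -> F \in X ->
    {in F, forall v, v \in vertices (stars A X)} ->
  F \in stars A X.
Proof.
elim: n X A W prec F => [|n IH] X A W prec F /=; first by case=> _ -> _; rewrite eqxx.
move=> [cX pX dX AX [W0 [WX XW indep] ordW [[a Wa EA] linkc _]]] A0 XF FA.
have {}XW : X = stars W X by case: XW => // -[_ EW]; rewrite EW eqxx in W0.
have AW : A \subset W by apply/subsetP => x; rewrite EA inE => /andP[].
have aA : a \in A by rewrite EA inE Wa eqxx.
have /bigcupP[w0 Ww0 Fw0] : F \in stars W X by rewrite -XW.
(* The choice of [w] as the last vertex whose star contains [F] is contradicted below, unless [w] is
   in [A], by a later such vertex. *)
have [w Ww [Fw maxw]] := exists_last (P := fun w => F \in star w X) ordW Ww0 Fw0.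
have [wA|wA] := boolP (w \in A); first by apply/bigcupP; exists w.
(* If [w] were in [F], it would lie in the star of some member of [A], and independence of [W] would
   put [w] itself in [A]. *)
have wF : w \notin F.
  apply/negP => /FA; rewrite inE => /bigcupP[a' Aa' waa'].
  have Ewa : w = a'.
    by apply: (star_vertex_W cX indep Ww (subsetP AW _ Aa')); rewrite inE.
  by rewrite Ewa Aa' in wA.
have prec_wA : {in A, forall y, prec w y}.
  by rewrite EA in wA *; apply: from_onP.
have LF : F \in link w X by rewrite mem_link wF -mem_star.
(* In dimension 0 the link condition is waived, but there [F] is empty and lies in every star. *)
have [lt1X|] := ltnP 1 (dim1 X); last first.
  move=> le1; have : #|w |: F| <= 1 by rewrite (leq_trans _ le1) // leq_dim1 // -mem_star.
  rewrite cardsU1 wF ltnS leqn0 cards_eq0 => /eqP F0.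
  apply/bigcupP; exists a => //; rewrite F0 mem_star // setU0.
  by have := subsetP WX _ Wa; rewrite inE.
have [] := linkc lt1X w Ww.
  case=> _ /(_ a Wa); rewrite eq_sym; case: eqVneq => [Ewa|_ /(_ isT) aw].
    by rewrite Ewa aA in wA.
  have := prec_trans ordW Ww Wa Ww (prec_wA a aA) aw.
  by rewrite (prec_irr ordW).
move=> U [U0 UL EU [W' [prec' SD]]].
(* All members of [A] come after [w], so every vertex of [F] lies in the overlap, which is
   [stars U (link w X)]; the induction hypothesis for the link applies. *)
have : F \in stars U (link w X).
  apply: (IH _ _ _ _ _ SD) => // v vF; rewrite inE EU inE.
  apply/andP; split; first by apply: (link_complex cX) LF _; rewrite sub1set.
  have := FA v vF; rewrite inE => /bigcupP[a' Aa' va'].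
  by apply/bigcupP; exists a' => //; rewrite inE (subsetP AW) ?prec_wA.
rewrite EU => /setIP[_ /bigcupP[w2]]; rewrite inE => /andP[Ww2 ww2] Fw2.
have /orP[/eqP E2|w2w] := maxw _ Ww2 Fw2.
  by rewrite E2 (prec_irr ordW) in ww2.
have := prec_trans ordW Ww Ww2 Ww ww2 w2w.
by rewrite (prec_irr ordW).
Qed.

(* Applied to [L = link w X] and [Y = stars (after W prec w) X]: once [us] is
   shed, what is left of the link of [w] lies in [Y], so shedding [w] leaves
   exactly [Y]. *)
Definition sheds_into d L Y (us : seq T) : Prop :=
  [/\ uniq us, us =i vertices L :\: vertices Y, sheds d L us,
      deletions L us \subset Y
    & vertex_decomposable (deletions L us) /\ dim1 (deletions L us) = d].

(** As [U] is a final segment, the vertices of [L] in [Y] are those whose last star is centred in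
    [U]. Any order extending the derived one therefore lists the vertices outside [Y] first. *)
Lemma shedding_split_into n L U W prec Y us rest :
    star_decomposition_at n.+1 L U W prec -> U != set0 ->
    simplicial_complex Y -> stars U L = L :&: Y ->
    shedding_split n.+1 L us rest ->
    pairwise (fun x y => ~~ derived_order L W prec y x) (us ++ rest) ->
  exists us', sheds_into n.+1 L Y us'.
Proof.
move=> SD U0 cY EU sp pw; have [vs_uniq vsE sh rest_d _] := sp.
move: (SD) => [cL pL dL UL [W0 [WL LW indep] ordW [[u0 Wu0 EUW] _ _]]].
have {}LW : L = stars W L by case: LW => // -[_ EW]; rewrite EW eqxx in W0.
pose P v := v \notin vertices Y.
have UY v : v \in vertices L -> (v \in vertices Y) = (v \in vertices (stars U L)).
  by rewrite EU !inE => ->.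
have pwP : pairwise (fun x y => P y ==> P x) (us ++ rest).
  have all_vs : all [in us ++ rest] (us ++ rest) by apply/allP.
  apply: sub_in_pairwise all_vs pw => x y xL yL /=.
  apply: contraR; rewrite negb_imply negbK => /andP[yY xY].
  rewrite [_ \in _]vsE in xL; rewrite [_ \in _]vsE in yL; rewrite /derived_order xL yL /=; apply/orP; left.
  have [Wpx _ px_max] := last_starP ordW LW xL.
  have [Wpy ypy _] := last_starP ordW LW yL.
  have pxU : last_star L W prec x \in from_on W prec u0.
    move: xY; rewrite UY // inE => /bigcupP[u Uu xu].
    move: (Uu); rewrite EUW !inE Wpx => /andP[Wu uu0] /=.
    have /orP[/eqP<- //|upx] : (u == last_star L W prec x) || prec u (last_star L W prec x).
      by apply: px_max; rewrite // in_set.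
    case/orP: uu0 => [/eqP<-|u0u]; first by rewrite upx orbT.
    by rewrite (prec_trans ordW Wu0 Wu Wpx u0u upx) orbT.
  apply: from_onP pxU => //; apply: contra yY => pyU.
  rewrite /P UY // inE; apply/bigcupP.
  by exists (last_star L W prec y); [rewrite EUW | rewrite inE in ypy].
have Evs := filter_prefix pwP.
set B := filter P _ in Evs; set C := filter _ _ in Evs.
have BE : B =i vertices L :\: vertices Y.
  by move=> v; rewrite mem_filter vsE in_setD.
(* A face avoiding [B] has all its vertices in [stars U L], and [stars_induced] then places the face
   itself there. *)
have delB : deletions L B = stars U L.
  apply/setP => F; rewrite mem_deletions.
  apply/andP/idP => [[LF /forall_inP FB]|SF].
    apply: (stars_induced SD) => // v vF; have vL := mem_vertices cL LF vF.
    by rewrite -UY //; move: (FB v vF); rewrite BE in_setD vL andbT negbK.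
  have /setIP[LF YF] : F \in L :&: Y by rewrite -EU.
  split=> //; apply/forall_inP => v vF.
  by rewrite BE in_setD (mem_vertices cY YF vF).
(* A facet of [L] through a vertex of [U] lies in [Y], which gives [n.+1] vertices in [C]. Hence [B]
   stops before [rest] and is a prefix of [us]. *)
have leC : n.+1 <= size C.
  have [u Uu] := set0Pn _ U0.
  have Lu : [set u] \in L by have := subsetP UL _ Uu; rewrite inE.
  have [F fF uF] := facet_above Lu.
  have LF : F \in L by move: fF; rewrite inE => /maxsetP[].
  have /setIP[_ YF] : F \in L :&: Y.
    rewrite -EU; apply/bigcupP; exists u; rewrite // mem_star //.
    by rewrite (setUidPr uF).
  rewrite -dL -(card_facet pL fF) (leq_trans _ (card_size C)) //.
  apply/subset_leq_card/subsetP => v vF.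
  rewrite mem_filter /= /P negbK (mem_vertices cY YF vF) vsE.
  exact: mem_vertices LF vF.
have leB : size B <= size us.
  have := congr1 size Evs; rewrite !size_cat rest_d => Esize.
  by rewrite -(leq_add2r n.+1) Esize leq_add2l.
have Eus : us = B ++ drop (size B) us.
  rewrite -{1}(cat_take_drop (size B) us); congr cat.
  by rewrite -(@takel_cat _ _ us rest) // Evs take_size_cat.
exists B; split=> //.
- by rewrite filter_uniq.
- by move: sh; rewrite Eus => /sheds_cat[].
- by rewrite delB EU subsetIr.
- by rewrite Eus in sp; apply: shedding_split_vertex_decomposable sp.
Qed.

(** * Assembling the shedding order star by star *)

Lemma stars_cons X w (t : seq T) :
  stars [set x in w :: t] X = star w X :|: stars [set x in t] X.
Proof. by rewrite set_cons /stars bigcup_setU big_set1. Qed.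

Lemma star_decomposition_split n X A W prec :
    star_decomposition_at n X A W prec ->
  exists us rest, shedding_split n X us rest /\
    pairwise (fun x y => ~~ derived_order X W prec y x) (us ++ rest).
Proof.
elim: n X A W prec => [|n IH] X A W prec /=.
  case=> -> _ _; exists [::], [::]; split=> //; split=> //.
    by move=> v; rewrite !inE; apply/esym/negbTE/set0Pn; exists v; rewrite inE.
  by exists set0; rewrite ?cards0 // /simplex powerset0.
move=> [cX pX dX _ [W0 [WX XW indep] ordW [_ linkc lastc]]].
have {}XW : X = stars W X by case: XW => // -[_ EW]; rewrite EW eqxx in W0.
have [ws wsE ws_pw] := prec_sorted ordW.
set p := last_star X W prec; set r := derived_order X W prec.
have vL w : vertices (link w X) \subset vertices X :\ w by apply: link_vertices.
have starL w v : w \in W -> (v \in vertices (star w X)) = (v == w) || (v \in vertices (link w X)).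
  move=> Ww; rewrite [LHS]in_set mem_star // [v \in vertices (link w X)]in_set.
  rewrite mem_link in_set1 (eq_sym w).
  case: eqVneq => //= ->; rewrite setUid.
  by have := subsetP WX _ Ww; rewrite inE.
(* The order [r] is that of the whole of [X] for every suffix [t], so the lists found for successive
   stars can be concatenated. *)
pose claim (t : seq T) := exists us rest, shedding_split n.+1 (stars [set x in t] X) us rest /\
    pairwise (fun x y => ~~ r y x) (us ++ rest).
suff claims (pre t : seq T) : ws = pre ++ t -> t != [::] -> claim t.
  have -> : X = stars [set x in ws] X.
    by rewrite {1}XW; congr stars; apply/setP => x; rewrite inE wsE.
  apply: (claims [::]) => //; apply: contraNneq W0 => ws0.
  by apply/eqP/setP => x; rewrite -wsE ws0 !inE.
elim: t pre => // w t IHt pre Ews _.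
have afterE : after W prec w = [set x in t].
  by apply: (after_suffix ordW (pre := pre)); rewrite -Ews.
have Ww : w \in W by rewrite -wsE Ews mem_cat mem_head orbT.
have cL := link_complex (v := w) cX.
have neq_w v : v \in vertices (link w X) -> v != w.
  by move=> /(subsetP (vL w)); rewrite in_setD1 => /andP[].
have wL : w \notin vertices (link w X) by apply/negP => /neq_w; rewrite eqxx.
set Y := stars [set x in t] X.
have cY : simplicial_complex Y by apply: stars_complex.
have EY : stars [set x in w :: t] X = Y :|: cone w (link w X).
  by rewrite stars_cons star_cone // setUC.
have wY : w \notin vertices Y.
  rewrite inE; apply/negP => /bigcupP[x]; rewrite inE => xt wx.
  have : x \in after W prec w by rewrite afterE inE.
  rewrite inE => /andP[Wx]; rewrite -(star_vertex_W cX indep Ww Wx) ?in_set //.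
    by rewrite (prec_irr ordW).
  by move: wx; rewrite !in_set.
(* A vertex outside [Y] lies in no star after that of [w]. *)
have pE z : z \in vertices (star w X) -> z \notin vertices Y -> p z = w.
  move=> zw zY; have vzX : z \in vertices X.
    by rewrite inE in zw; rewrite inE; move: zw; rewrite inE => /andP[].
  have [Wp zp maxp] := last_starP ordW XW vzX.
  have /orP[/eqP->//|wp] := maxp _ Ww zw.
  case/negP: zY; rewrite inE; apply/bigcupP; exists (p z).
    by rewrite -afterE inE Wp.
  by rewrite inE in zp.
(* Such a [B] consists of the vertices [v != w] with [p v = w]. *)
have before_w (B : seq T) : uniq B ->
    B =i vertices (link w X) :\: vertices Y ->
    [/\ uniq (rcons B w), rcons B w =i vertices (stars [set x in w :: t] X) :\: vertices Y
      & pairwise (fun x y => ~~ r y x) (rcons B w)].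
  move=> uB BE; have wB : w \notin B by rewrite BE in_setD (negPf wL) andbF.
  have BwE : rcons B w =i vertices (stars [set x in w :: t] X) :\: vertices Y.
    move=> v; rewrite mem_rcons inE BE !in_setD stars_cons.
    have -> : (v \in vertices (star w X :|: Y)) = (v \in vertices (star w X)) || (v \in vertices Y).
      by rewrite !inE.
    rewrite starL //; case: eqVneq => [->|_] /=; first by rewrite wY.
    by case: (v \in vertices Y); rewrite ?orbF.
  have pB x : x \in rcons B w -> p x = w.
    rewrite BwE in_setD => /andP[xY xS]; apply: pE => //.
    by move: xS xY; rewrite stars_cons !inE => /orP[-> //|->].
  rewrite rcons_uniq wB uB; split=> //.
  (* Vertices with the same last star [w] are comparable only when the larger one is [w], which is
     not in [B]. *)
  have ltB x y : x \in B -> y \in rcons B w -> ~~ r y x.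
    move=> xB yB; have pxw : p x = w by apply: pB; rewrite mem_rcons inE xB orbT.
    rewrite /r /derived_order -/p pxw (pB _ yB) (prec_irr ordW) //=.
    case: eqVneq => [wx|]; last by rewrite !andbF.
    by rewrite -wx (negPf wB) in xB.
  rewrite pairwise_rcons; apply/andP; split.
    by apply/allP => x xB; apply: ltB; rewrite // mem_rcons mem_head.
  apply/(pairwiseP w) => i j; rewrite !inE => iB jB _.
  by apply: ltB; rewrite ?mem_rcons ?inE mem_nth ?orbT.
have [t0|t_n0] := eqVneq t [::].
  have Y0 : Y = set0.
    by apply/setP => s; rewrite inE /Y t0; apply/bigcupP => -[x]; rewrite inE.
  have lastw : is_last W prec w.
    split=> // w' Ww' w'w; case: (ordW) => _ _ /(_ _ _ Ww' Ww w'w)/orP[//|ww'].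
    have : w' \in after W prec w by rewrite inE Ww'.
    by rewrite afterE t0 inE.
  have [U UL [W' [prec' SD]]] := lastc w lastw.
  have [us [rest [[uniq_us usE sh rest_d [s ds Ks]] _]]] := IH _ _ _ _ SD.
  have [|uw wE pw] := before_w (us ++ rest) uniq_us.
    by move=> v; rewrite usE Y0 !inE.
  (* The apex [w] is not shed: it joins the final simplex, the cone over that of the link. *)
  exists us, (rcons rest w); rewrite -rcons_cat; split=> //; split=> //.
  - by rewrite -rcons_cat.
  - by move=> v; rewrite -rcons_cat wE in_setD Y0 !inE.
  - rewrite EY; apply: sheds_setU_cone => // v vus.
    have vL' : v \in vertices (link w X) by rewrite -usE mem_cat vus.
    by rewrite Y0 in_set in_set0 neq_w.
  - by rewrite size_rcons rest_d.
  - exists (w |: s).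
      rewrite cardsU1 ds; suff -> : w \notin s by [].
      apply: contra wL => ws'; rewrite inE.
      have : [set w] \in deletions (link w X) us by rewrite Ks powersetE sub1set.
      by rewrite mem_deletions => /andP[].
    rewrite EY deletions_setU_cone //.
      by rewrite Ks cone_simplex Y0 set0U.
    move=> v vus; have vL' : v \in vertices (link w X) by rewrite -usE mem_cat vus.
    by rewrite Y0 in_set in_set0 neq_w.
(* As [t] is nonempty, [head w t] is a genuine later vertex, showing that [w] is not last. *)
have [Wx wx tx] : [/\ head w t \in W, prec w (head w t) & head w t \in t].
  have xt : head w t \in t by case: (t) t_n0 => //= x u _; apply: mem_head.
  have : head w t \in after W prec w by rewrite afterE inE.
  by rewrite inE => /andP[].
have not_last : ~ is_last W prec w.
  case=> _ lastw; have xw : head w t != w.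
    by apply: contraTneq wx => ->; rewrite (prec_irr ordW).
  have := prec_trans ordW Ww Wx Ww wx (lastw _ Wx xw).
  by rewrite (prec_irr ordW).
have [B [uB BE shB BY [vdB dB]]] : exists B : seq T, sheds_into n (link w X) Y B.
  case: n IH dX linkc {lastc claim IHt} => [|n] IH dX linkc.
    (* In dimension 0 there is no set [U] to use; the link is [[set set0]], so nothing is shed
       before [w]. *)
    have EL : link w X = [set set0].
      apply/setP => s; rewrite mem_link inE; apply/andP/eqP => [[ws' Xs]|->].
        by have := leq_dim1 Xs; rewrite dX cardsU1 ws' ltnS leqn0 cards_eq0 => /eqP.
      by rewrite inE setU0; have := subsetP WX _ Ww; rewrite inE.
    have EL' : link w X = simplex set0 by rewrite EL /simplex powerset0.
    exists [::]; split=> //=.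
    - move=> v; rewrite in_setD EL !inE; apply/esym/andP => -[_ /eqP/setP/(_ v)].
      by rewrite !inE eqxx.
    - rewrite EL sub1set; apply/bigcupP; exists (head w t); first by rewrite inE.
      by rewrite mem_star // setU0; have := subsetP WX _ Wx; rewrite inE.
    - by rewrite EL' dim1_simplex cards0; split=> //; apply: VD_simplex.
  have [|U [U0 UL EU [W' [prec' SD]]]] := linkc _ w Ww not_last; first by rewrite dX.
  have [us [rest [sp pw]]] := IH _ _ _ _ SD.
  by apply: (shedding_split_into SD U0 cY _ sp pw); rewrite EU /overlap afterE.
have [uBw BwE pwB] := before_w B uB BE.
have [us [rest [[uniq_us usE sh rest_d [s ds Ks]] pw]]] :
    claim t by apply: (IHt (rcons pre w)); rewrite // cat_rcons.
have B_out v : v \in B -> v \notin vertices Y /\ v != w.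
  rewrite BE in_setD => /andP[vY vLw]; split=> //.
  exact: neq_w.
have notin_M F : F \in deletions (link w X) B -> w \notin F.
  rewrite mem_deletions mem_link -andbA => /andP[wF _] //.
(* The base left after shedding [B] is contained in [Y], so only the faces containing [w]
   disappear. *)
have delw : deletion (Y :|: cone w (deletions (link w X) B)) w = Y.
  apply/setP => F; rewrite !inE; apply/andP/idP => [[/orP[//|]]|YF].
    move=> MF wF; apply: (subsetP BY).
    by rewrite -(_ : F :\ w = F) //; apply/setDidPl; rewrite disjoint_sym disjoints1.
  by rewrite YF; split=> //; apply: contra wY => wF; apply: mem_vertices YF wF.
have linkw : link w (Y :|: cone w (deletions (link w X) B)) = deletions (link w X) B.
  apply/setP => F; rewrite mem_link; apply/andP/idP => [[wF]|MF].
    rewrite !inE setU1K // => /orP[YF|//].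
    case/negP: wY; apply: mem_vertices YF _ => //; exact: setU11.
  have wF := notin_M F MF.
  by rewrite !inE setU1K // MF orbT.
exists (rcons B w ++ us), rest; rewrite -catA.
have vsE v : (v \in rcons B w ++ us ++ rest) = (v \in vertices (stars [set x in w :: t] X)).
  rewrite mem_cat BwE usE in_setD stars_cons -/Y.
  have -> : (v \in vertices (star w X :|: Y)) = (v \in vertices (star w X)) || (v \in vertices Y).
    by rewrite !inE.
  by case: (v \in vertices Y); rewrite /= ?orbT ?orbF.
split; first split.
- rewrite -catA cat_uniq uBw uniq_us andbT /=; apply/hasPn => v.
  by rewrite usE BwE in_setD => ->.
- by move=> v; rewrite -catA vsE.
- apply/sheds_cat; rewrite EY -cats1; split.
    apply/sheds_cat; split; first exact: sheds_setU_cone.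
    rewrite deletions_setU_cone //= linkw; split; rewrite ?dB //.
    rewrite !inE (_ : [set w] :\ w = set0) ?setDv //.
    have /set0Pn[F MF] := vertex_decomposable_neq0 vdB.
    by rewrite (vertex_decomposable_complex vdB MF (sub0set _)) orbT.
  by rewrite /deletions foldl_cat -/(deletions _ B) deletions_setU_cone //= delw.
- exact: rest_d.
- exists s => //; rewrite EY -cats1 -catA /deletions foldl_cat -/(deletions _ B).
  by rewrite deletions_setU_cone //= delw.
(* For pairs across the two lists, [p x] is [w] while [p y] comes after [w]. *)
rewrite pairwise_cat pwB pw !andbT; apply/allrelP => x y xB.
rewrite usE => yY.
have pxw : p x = w.
  move: xB; rewrite BwE in_setD => /andP[xY xS]; apply: pE => //.
  by move: xS xY; rewrite stars_cons !inE => /orP[-> //|->].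
have [Wpy wpy] : p y \in W /\ prec w (p y).
  move: (yY); rewrite inE => /bigcupP[z]; rewrite -afterE inE => /andP[Wz wz] yz.
  have vyX : y \in vertices X by move: yz; rewrite !inE => /andP[].
  have [Wp _ maxp] := last_starP ordW XW vyX; split=> //.
  have /orP[/eqP<- //|zp] : (z == p y) || prec z (p y) by apply: maxp; rewrite // in_set.
  by rewrite (prec_trans ordW Ww Wz Wp wz zp).
rewrite /r /derived_order -/p pxw; apply/negP => /and3P[_ _ /orP[pyw|/and3P[xW /eqP pyx _]]].
  have := prec_trans ordW Ww Wpy Ww wpy pyw.
  by rewrite (prec_irr ordW).
have Exw : x = w by rewrite -pxw /p (last_starW cX ordW WX XW indep xW).
by rewrite pyx Exw (prec_irr ordW) in wpy.
Qed.

End Complexes.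

Theorem theorem7 (T : finType) (X : {set {set T}}) (W : {set T})
    (prec : rel T) :
  simplicial_complex X ->
  star_decomposable X ->
  W \subset vertices X ->
  star_partition X W ->
  strict_total_order_on W prec ->
  induces_star_decomposition X W prec ->
  exists vs : seq T,
    [/\ enumerates_vertices X vs,
        extends vs (derived_order X W prec)
      & shedding_order X vs].
Proof.
move=> cX _ WX [_ XW indep] ordW [A _ SD].
have [us [rest [sp pw]]] := star_decomposition_split SD.
have so := shedding_split_order cX sp.
exists (us ++ rest); split=> //; first by case: so.
have [_ vsE _ _ _] := sp.
apply: pairwise_extends pw => [|x y /and3P[xX yX _]]; last by rewrite !vsE.
(* The complex [[set set0]] has no vertices, so its derived order relates nothing. *)
case: XW => [[EX _]|XW]; last exact: derived_order_irr.
move=> v; apply/negP => /and3P[]; rewrite EX !inE => /eqP/setP/(_ v).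
by rewrite !inE eqxx.
Qed.
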